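(* Let $A$ and $B$ be subsets of an elementary abelian $2$-group $G$ such that $\langle A\rangle=\langle B\rangle=G$. If $|A+B|<\min\{|A|+|B|,|G|\}$, then the complement of $A+B$ in $G$ is contained in a coset of a subgroup of $G$ of index $8$. Moreover, if $\mu_{A,B}=1$, then the containment is strict (that is, the complement $G\setminus(A+B)$ is a proper subset of some coset of a subgroup of index $8$).
   Context: An elementary abelian $2$-group is a finite abelian group of exponent $2$. For subsets $A,B$ of an abelian group, $A+B:=\{a+b\colon a\in A,\ b\in B\}$. The notation $\langle A\rangle$ denotes the affine span of $A$, i.e. the smallest coset (of a subgroup) that contains $A$; thus $\langle A\rangle=G$ means that $A$ is not contained in a coset of a proper subgroup of $G$ (note that $\langle A\rangle$ is not the subgroup generated by $A$). For a group element $g$, $\nu_{A,B}(g)$ denotes the number of representations of $g$ in the form $g=a+b$ with $a\in A$ and $b\in B$ (i.e. the number of such pairs $(a,b)\in A\times B$), and $\mu_{A,B}:=\min\{\nu_{A,B}(g)\colon g\in A+B\}$. *)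

(* Defs.v *)
From mathcomp Require Import all_boot all_fingroup all_solvable.

Set Implicit Arguments.
Unset Strict Implicit.
Unset Printing Implicit Defensive.

Import GroupScope.

(* Groups are written multiplicatively, so the sumset A + B is the product set
   A * B. *)

Section SumsetNotions.

Variable gT : finGroupType.
Implicit Types (G H : {group gT}) (A B S T : {set gT}) (g : gT).

(* Right cosets are used to match the definition of #|G : H|; in an abelian
   group they are the same as left cosets. *)
Definition coset_in G S : Prop :=
  exists2 H : {group gT}, H \subset G & S \in rcosets H G.

(* The affine span is given as a relation because the empty set has none when
   G is nontrivial: the cosets of the trivial subgroup are disjoint. *)
Definition is_affine_span G A S : Prop :=
  [/\ coset_in G S, A \subset S
    & forall T, coset_in G T -> A \subset T -> S \subset T].

Definition nu A B g : nat := #|[set ab in setX A B | ab.1 * ab.2 == g]|.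

(* Every nu A B g is at most #|setX A B|, so the initial value is absorbed
   unless A * B is empty, in which case mu A B = 0. *)
Definition mu A B : nat :=
  \big[minn/#|setX A B|]_(g in A * B) nu A B g.

End SumsetNotions.

(* Main.v *)
Require Import Defs.
From mathcomp Require Import all_boot all_fingroup all_solvable.
From mathcomp Require Import zify.

Set Implicit Arguments.
Unset Strict Implicit.
Unset Printing Implicit Defensive.

Import GroupScope.

(** Write C for the complement of A * B in G.  In an elementary abelian 2-group
the relation between A, B and C is symmetric: no product of an element of A, one
of B and one of C is 1.  The hypothesis on A * B becomes
#|A * C| < #|A| + #|C|, and we may assume #|A| <= #|B|, so that
2 * #|A| <= #|G|.

The excess of a set X is #|A * X| - #|X|, where X ranges over the nonempty
subsets of G with A * X <> G.  It is submodular
([card_mulg_submodular]), and C has excess less than #|A|.  Let k be its least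
value; the sets that attain it are the fragments.  If Y is a smallest fragment,
then submodularity forces any translate x * Y that meets Y to equal Y.  For u
and v in Y the translate (u * v) * Y meets Y, because (u * v) * v = u; hence Y
is a coset of a subgroup.  The same argument works among the fragments that are
unions of cosets of a subgroup H, are larger than H and leave more than #|H|
elements outside their product with A, because the intersection of Y with its
translate is stable under u * v and so, for u * v outside H, cannot reduce to a
single coset of H ([periodic_fragment_group]).

Let H be a largest subgroup that is a fragment.  Then no union of two or more
cosets of H is a fragment that leaves at least two cosets of H outside its
product with A.  This forces C into one coset of H.  Suppose that c and d lie
in C, in different cosets.  The set A * c avoids B, and it lacks fewer than
#|H| elements of A * c * H, so B has fewer than #|H| elements in A * c * H, and
likewise in A * d * H.  The rest of B lies outside A * (C :|: c * H :|: d * H),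
and by the choice of H this leaves room for at most #|H| elements
([card_gap_grown]).  So #|B| < 3 * #|H|.  But a set whose affine span has
dimension n has more than n points, which applied modulo H ([span_card]) gives
4 * #|H| <= #|A * H| = k + #|H|, whence 3 * #|H| <= k < #|A| <= #|B|, a
contradiction.

The same inequality gives 6 * #|H| <= 2 * k < 2 * #|A| <= #|G|, so H has index
at least 8 and can be enlarged to a subgroup of index 8.

If C is a full coset of a subgroup H of index 8, then A * H and B * H
both consist of four cosets, and A, B together lack fewer than #|H| elements of
those eight.  Since A spans G, A * H has at least two cosets outside each
translate t * A * H with t not in H; so every element of A * B is a product of
cosets, one from A * H and one from B * H, in at least two ways, and the few
missing elements cannot reduce these to a single representation
([full_coset_gap_nu]). *)

(** * Cardinals of product sets and unions of cosets *)

(** A set over a finGroupType is elaborated over either of two convertible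
finType structures, which linear arithmetic would treat as giving distinct
cardinals; the tactic identifies them and abstracts every cardinal first. *)
Ltac card_lia :=
  repeat match goal with
  | H : is_true (leq _ _) |- _ => revert H
  | H : @eq nat _ _ |- _ => revert H
  end;
  repeat match goal with
  | |- context [fingroup_FinStarMonoid__to__fintype_Finite
         (fingroup_FinGroup__to__fingroup_FinStarMonoid ?T)] =>
    change (fingroup_FinStarMonoid__to__fintype_Finite
      (fingroup_FinGroup__to__fingroup_FinStarMonoid T))
      with (fingroup_FinGroup__to__fintype_Finite T)
  end;
  repeat match goal with
  | |- context [@card ?T ?m] =>
    let n := fresh in generalize (@card T m) => n
  end;
  clear; lia.

Lemma card_mulg_submodular (gT : finGroupType) (A X Y : {set gT}) :
  #|A * (X :|: Y)| + #|A * (X :&: Y)| <= #|A * X| + #|A * Y|.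
Proof.
rewrite mulgU -[leqRHS]cardsUI leq_add2l subset_leq_card // subsetI.
by rewrite !mulgS ?subsetIl ?subsetIr.
Qed.

(** The set X * H is the disjoint union of orbits of H acting by right
translation, and these are its left cosets. *)
Lemma dvdn_card_mulG (gT : finGroupType) (X : {set gT}) (H : {group gT}) :
  #|H| %| #|X * H|.
Proof.
have actsH : [acts H, on X * H | 'R].
  apply/actsP=> h Hh y /=; apply/mulsgP/mulsgP=> [] [x k Xx Hk def_y].
    exists x (k * h^-1); rewrite // ?groupM ?groupV //.
    by rewrite mulgA -def_y mulgK.
  by exists x (k * h); rewrite ?groupM // mulgA -def_y.
rewrite (card_uniform_partition (n := #|H|) _ (orbit_partition actsH)).
  exact: dvdn_mull.
by move=> _ /imsetP[x _ ->]; rewrite orbitR card_lcoset.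
Qed.

Lemma periodic_of_closed (gT : finGroupType) (Z : {set gT}) (H : {group gT}) :
  (forall z h, z \in Z -> h \in H -> z * h \in Z) -> Z * H = Z.
Proof.
move=> closedZ; apply/eqP; rewrite eqEsubset mulG_subl andbT.
by apply/subsetP=> _ /mulsgP[z h Zz Hh ->]; apply: closedZ.
Qed.

Lemma periodic_mem (gT : finGroupType) (Z : {set gT}) (H : {group gT}) z h :
  Z * H = Z -> h \in H -> (z * h \in Z) = (z \in Z).
Proof.
move=> ZH Hh; apply/idP/idP=> Zz; last by rewrite -ZH mem_mulg.
by rewrite -(mulgK h z) -ZH mem_mulg ?groupV.
Qed.

Lemma periodicI (gT : finGroupType) (Y Z : {set gT}) (H : {group gT}) :
  Y * H = Y -> Z * H = Z -> (Y :&: Z) * H = Y :&: Z.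
Proof.
move=> YH ZH; apply: periodic_of_closed => z h /setIP[Yz Zz] Hh.
by rewrite inE (periodic_mem _ YH Hh) (periodic_mem _ ZH Hh) Yz.
Qed.

Lemma periodicD (gT : finGroupType) (Y Z : {set gT}) (H : {group gT}) :
  Y * H = Y -> Z * H = Z -> (Y :\: Z) * H = Y :\: Z.
Proof.
move=> YH ZH; apply: periodic_of_closed => z h /setDP[Yz Zz] Hh.
by rewrite inE (periodic_mem _ YH Hh) (periodic_mem _ ZH Hh) Yz Zz.
Qed.

Lemma card_lcosetU (gT : finGroupType) (H : {group gT}) (u v : gT) :
  v \notin u *: H -> #|u *: H :|: v *: H| = (2 * #|H|)%N.
Proof.
move=> uHv; have dis : [disjoint u *: H & v *: H].
  apply/pred0P=> y /=; apply/negP=> /andP[uHy vHy]; case/negP: uHv.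
  by apply: lcoset_trans uHy; rewrite lcoset_sym.
have := cardsUI (u *: H) (v *: H).
by rewrite (disjoint_setI0 dis) cards0 !card_lcoset; card_lia.
Qed.

(** * Elementary abelian 2-groups *)

Section ElementaryAbelian.

Variables (gT : finGroupType) (G : {group gT}).
Hypothesis abelG : abelian G.
Hypothesis sqG1 : {in G, forall x, x * x = 1}.
Implicit Types (A B X Y : {set gT}) (H K : {group gT}).

Lemma commG : {in G &, commutative (@mulg gT)}.
Proof. by move=> x y Gx Gy; exact: (centsP abelG). Qed.

Lemma invG : {in G, forall x, x^-1 = x}.
Proof. by move=> x Gx; apply/eqP; rewrite eq_invg_mul sqG1. Qed.

Lemma mulKG x y : x \in G -> x * (x * y) = y.
Proof. by move=> Gx; rewrite mulgA sqG1 ?mul1g. Qed.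

Lemma set_commG X Y : X \subset G -> Y \subset G -> X * Y = Y * X.
Proof.
move=> sXG sYG; apply: centC.
by apply: subset_trans sXG (subset_trans abelG (centS sYG)).
Qed.

Lemma mulg_lcoset A X x : A \subset G -> x \in G -> A * (x *: X) = x *: (A * X).
Proof. by move=> sAG Gx; rewrite !mulgA (set_commG sAG) ?sub1set. Qed.

Lemma lcoset_sub X x : X \subset G -> x \in G -> x *: X \subset G.
Proof. by move=> sXG Gx; rewrite mul_subG ?sub1set. Qed.

Lemma mem_lcosetG X x y : x \in G -> (y \in x *: X) = (x * y \in X).
Proof. by move=> Gx; rewrite mem_lcoset invG. Qed.

(** Both inclusions say that no product of an element of A, one of X and one
of Y is 1; this symmetry is what lets the complement of A * B play the role of
B. *)
Lemma mulg_disjointC A X Y :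
    A \subset G -> X \subset G -> Y \subset G ->
  X \subset G :\: A * Y -> Y \subset G :\: A * X.
Proof.
move=> sAG sXG sYG /subsetP XAY; apply/subsetP=> y Yy.
rewrite inE (subsetP sYG) // andbT; apply/negP=> /mulsgP[a x Aa Xx def_y].
have /setDP[_ /negP[]] := XAY x Xx; apply/mulsgP; exists a y => //.
by rewrite def_y mulKG // (subsetP sAG).
Qed.

Lemma joing_cycle K x : K \subset G -> x \in G ->
  K <*> <[x]> = K :|: x *: K.
Proof.
move=> sKG Gx; have sxG : <[x]> \subset G by rewrite cycle_subG.
have -> : K <*> <[x]> = <[x]> * K.
  by rewrite joingC norm_joinEl // (subset_trans sxG) // sub_abelian_norm.
have -> : <[x]> = [set 1; x].
  have [-> | ntx] := eqVneq x 1; first by rewrite cycle1 setUid.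
  by rewrite cycle2g // (nt_prime_order (p := 2)) // expgS expg1 sqG1.
by rewrite mulUg mul1g.
Qed.

Lemma card_joing_cycle K x : K \subset G -> x \in G ->
  #|K <*> <[x]>| <= 2 * #|K|.
Proof.
move=> sKG Gx; rewrite joing_cycle // mul2n -addnn.
rewrite -[X in _ + X](card_lcoset K x).
by rewrite -cardsUI leq_addr.
Qed.

(** * Affine spans *)

Section Span.

Variable A : {set gT}.
Hypothesis sAG : A \subset G.
Hypothesis spanA : is_affine_span G A G.

Lemma span_escape K a : K \subset G -> a \in G -> #|K| < #|G| ->
  exists2 x, x \in A & x \notin a *: K.
Proof.
move=> sKG Ga ltKG; have [_ _ minG] := spanA.
apply/subsetPn; apply: contraL ltKG => sAK; rewrite -leqNgt.
rewrite -(card_lcoset K a) subset_leq_card // minG //; exists K => //.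
by apply/rcosetsP; exists a; rewrite ?(set_commG _ sKG) ?sub1set.
Qed.

Lemma span_gt0 : 1 < #|G| -> A != set0.
Proof.
rewrite -(cards1 (1 : gT)) => ltG.
have [|x Ax _] := @span_escape [1]%G 1 (sub1G _) (group1 _); first exact: ltG.
by apply/set0Pn; exists x.
Qed.

(** Modulo H this says that a set whose affine span has dimension greater than
n has at least n + 2 points: starting from one point of A, each new point of A
outside the affine span of the earlier ones doubles that span, so it takes at
least n + 1 further points to exceed 2 ^ n. *)
Lemma span_card H n : H \subset G -> 2 ^ n * #|H| < #|G| ->
  n.+2 * #|H| <= #|A * H|.
Proof.
move=> sHG lt_nG.
have /set0Pn[a Aa] : A != set0.
  apply: span_gt0; apply: leq_trans lt_nG.
  by rewrite ltnS muln_gt0 expn_gt0 cardG_gt0.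
have Ga := subsetP sAG a Aa.
suffices [K [sHK sKG _ leK]] : exists K : {group gT},
    [/\ H \subset K, K \subset G, #|K| <= 2 ^ n.+1 * #|H|
      & n.+2 * #|H| <= #|A * H :&: a *: K|].
  by apply: leq_trans leK _; rewrite subset_leq_card // subsetIl.
suffices step m (K : {group gT}) : H \subset K -> K \subset G ->
    #|K| <= 2 ^ m * #|H| -> m <= n -> m.+1 * #|H| <= #|A * H :&: a *: K| ->
  exists L : {group gT},
    [/\ H \subset L, L \subset G, #|L| <= 2 ^ m.+1 * #|H|
      & m.+2 * #|H| <= #|A * H :&: a *: L|].
- elim: {-2}n (leqnn n) => [|m IHm] lemn.
    apply: (step 0 H) => //; rewrite ?mul1n //.
    by rewrite (setIidPr _) ?card_lcoset // mulSg ?sub1set.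
  have [K [sHK sKG cK leK]] := IHm (ltnW lemn).
  exact: (step m.+1 K).
move=> sHK sKG cK lemn leK.
have [//|//||x Ax xK] := @span_escape K a.
  apply: leq_ltn_trans cK (leq_ltn_trans _ lt_nG).
  by rewrite leq_mul2r leq_exp2l // lemn orbT.
have Gx := subsetP sAG x Ax; exists (K <*> <[a * x]>)%G; split.
- exact: subset_trans sHK (joing_subl _ _).
- by rewrite join_subG sKG cycle_subG groupM.
- apply: leq_trans (card_joing_cycle _ _) _; rewrite ?groupM //.
  by rewrite expnS -mulnA leq_mul2l cK.
have dis : [disjoint A * H :&: a *: K & x *: H].
  rewrite disjoint_sym; apply/pred0P => y /=; apply/negP.
  case/andP=> /lcosetP[h Hh ->] /setIP[_ /lcosetP[k Kk def]]; case/negP: xK.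
  apply/lcosetP; exists (k * h^-1).
    by rewrite groupM ?groupV // (subsetP sHK).
  by rewrite mulgA -def mulgK.
rewrite mulSn addnC -[X in _ + X](card_lcoset H x).
apply: leq_trans (leq_add leK (leqnn _)) _.
rewrite -cardsUI (disjoint_setI0 dis) cards0 addn0.
apply: subset_leq_card; rewrite subUset setIS ?mulgS ?joing_subl //= subsetI.
rewrite mulSg ?sub1set //; apply/subsetP=> _ /lcosetP[h Hh ->].
rewrite mem_lcosetG // mulgA groupM //.
  by rewrite (subsetP (joing_subr _ _)) ?cycle_id.
by rewrite (subsetP (joing_subl _ _)) ?(subsetP sHK).
Qed.

End Span.

(** * Fragments *)

(** The number k bounds from below the excess #|A * X| - #|X|. *)
Definition excess_bound A k := forall X,
  X \subset G -> X != set0 -> A * X != G -> k + #|X| <= #|A * X|.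

(** A set that attains the bound k on the excess; this is meant for a k that
satisfies [excess_bound]. *)
Definition fragment A k X :=
  [&& X \subset G, X != set0, A * X != G & #|A * X| <= k + #|X|].

Lemma exists_fragment A X :
    A != set0 -> X \subset G -> X != set0 -> A * X != G ->
    #|A * X| < #|A| + #|X| ->
  exists k, [/\ excess_bound A k, k < #|A| & exists Y, fragment A k Y].
Proof.
move=> A0 sXG X0 AXG ltX.
pose P X := [&& X \subset G, X != set0 & A * X != G].
have PX : P X by rewrite /P sXG X0.
have [Y PY minY] : exists2 Y, P Y &
    forall Z, P Z -> #|A * Y| - #|Y| <= #|A * Z| - #|Z|.
  by case: (arg_minnP (fun Z => #|A * Z| - #|Z|) PX) => Y; exists Y.
have leA (Z : {set gT}) : #|Z| <= #|A * Z|.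
  have [a Aa] := set0Pn _ A0; rewrite -(card_lcoset Z a) subset_leq_card //.
  by rewrite mulSg ?sub1set.
have leAX := leA X; have leAY := leA Y; have leYX := minY X PX.
exists (#|A * Y| - #|Y|); split=> [Z sZG Z0 AZG||]; last first.
- exists Y; case/and3P: PY => sYG Y0 AYG.
  by rewrite /fragment sYG Y0 AYG; card_lia.
- by card_lia.
have := leA Z; have := minY Z; rewrite /P sZG Z0 AZG => /(_ isT).
by card_lia.
Qed.

Section Fragments.

Variables (A : {set gT}) (k : nat).
Hypothesis sAG : A \subset G.
Hypothesis excess_ge : excess_bound A k.

Lemma mulA_sub X : X \subset G -> A * X \subset G.
Proof. exact: mul_subG. Qed.

Lemma mulA_sub_gap X : X \subset G -> A * (G :\: A * X) \subset G :\: X.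
Proof.
move=> sXG; have sYG : G :\: A * X \subset G by apply: subsetDl.
have := mulg_disjointC sAG sYG sXG (subxx _); rewrite !subsetD mulA_sub //=.
by rewrite disjoint_sym => /andP[].
Qed.

Lemma card_gap X : X \subset G -> #|A * X| + #|G :\: A * X| = #|G|.
Proof.
by move=> sXG; rewrite -(cardsID (A * X) G) (setIidPr (mulA_sub sXG)).
Qed.

Lemma gap_neq0 X : X \subset G -> (G :\: A * X != set0) = (A * X != G).
Proof.
by move=> sXG; rewrite setD_eq0 eqEsubset mulA_sub.
Qed.

Lemma fragment_card X : fragment A k X -> #|A * X| = k + #|X|.
Proof.
by case/and4P=> sXG X0 AXG le; apply/eqP; rewrite eqn_leq le excess_ge.
Qed.

(** Duality: A * (G :\: A * X) avoids X, and is as large as this allows because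
its excess is at least k. *)
Lemma fragment_gap X : fragment A k X ->
  fragment A k (G :\: A * X) /\ A * (G :\: A * X) = G :\: X.
Proof.
move=> fX; case/and4P: (fX) => sXG X0 AXG _; have cX := fragment_card fX.
set Y := G :\: A * X; have sYG : Y \subset G by apply: subsetDl.
have sAY : A * Y \subset G :\: X by apply: mulA_sub_gap.
have cGX : #|G :\: X| + #|X| = #|G|.
  by rewrite -(cardsID X G) (setIidPr sXG) addnC.
have Y0 : Y != set0 by rewrite gap_neq0.
have AYG : A * Y != G.
  have [x Xx] := set0Pn _ X0; apply: contraTneq sAY => ->.
  by apply/subsetPn; exists x; rewrite ?(subsetP sXG) // inE Xx.
have leAY := excess_ge sYG Y0 AYG; have leG := subset_leq_card sAY.
have := card_gap sXG; rewrite -/Y => cG.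
have cAY : #|A * Y| = #|G :\: X| by card_lia.
split; last by apply/eqP; rewrite eqEcard sAY cAY /=.
by rewrite /fragment sYG Y0 AYG cAY; card_lia.
Qed.

Lemma fragment_lcoset X x : x \in G -> fragment A k X -> fragment A k (x *: X).
Proof.
move=> Gx /and4P[sXG X0 AXG leX].
rewrite /fragment lcoset_sub // mulg_lcoset // !card_lcoset leX andbT.
rewrite -card_gt0 card_lcoset card_gt0 X0 /=; apply: contra AXG => /eqP eqG.
by rewrite -(lcosetK x (A * X)) eqG lcoset_id ?groupV.
Qed.

(** Let I and U be the intersection and the union of Y and x * Y.  By duality
the complement of A * Y is no smaller than Y, so, I having more than t elements,
A * U still leaves elements of G uncovered and U has excess at least k.  By
submodularity I is then a fragment, and the minimality of Y gives I = Y. *)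
Lemma atom_lcoset H t Y x :
    H \subset G -> x \in G ->
    fragment A k Y -> Y * H = Y -> t < #|Y| -> t < #|G :\: A * Y| ->
    (forall Z, fragment A k Z -> Z * H = Z -> t < #|Z| -> t < #|G :\: A * Z| ->
      #|Y| <= #|Z|) ->
  t < #|Y :&: x *: Y| -> x *: Y = Y.
Proof.
move=> sHG Gx fY YH tY tgY minY tI; apply/eqP.
rewrite eq_sym eqEcard card_lcoset leqnn andbT.
apply: contraTT tI => neY; rewrite -leqNgt leqNgt; apply/negP=> tI.
case/and4P: (fY) => sYG Y0 AYG _; have cY := fragment_card fY.
have sxYG : x *: Y \subset G by apply: lcoset_sub.
set I := Y :&: _ in tI; pose U := Y :|: x *: Y.
have sIG : I \subset G by rewrite subIset ?sYG.
have sUG : U \subset G by rewrite subUset sYG.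
have I0 : I != set0 by rewrite -card_gt0; card_lia.
have sAI : A * I \subset A * Y by rewrite mulgS ?subsetIl.
have gapI : G :\: A * Y \subset G :\: A * I by rewrite setDS.
have AIG : A * I != G.
  rewrite -gap_neq0 // -card_gt0; apply: leq_trans (subset_leq_card gapI).
  by rewrite card_gt0 gap_neq0.
have cUI : #|U| + #|I| = (2 * #|Y|)%N.
  by rewrite cardsUI card_lcoset; card_lia.
have cAUI : #|A * U| + #|A * I| <= 2 * #|A * Y|.
  have := card_mulg_submodular A Y (x *: Y).
  by rewrite mulg_lcoset // card_lcoset -/U -/I; card_lia.
have leI := excess_ge sIG I0 AIG.
have [fY' gY'] := fragment_gap fY.
have leYY' : #|Y| <= #|G :\: A * Y|.
  apply: minY => //; first by rewrite periodicD ?mulGSid // -mulgA YH.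
  by rewrite gY' setDDr setDv set0U (setIidPr sYG).
have cG := card_gap sYG.
have neI : #|I| < #|Y|.
  rewrite proper_card // properEneq subsetIl andbT.
  by apply: contra neY => /eqP/setIidPl.
have cGI := card_gap sIG; have cGU := card_gap sUG.
have U0 : U != set0 by rewrite -card_gt0; card_lia.
have AUG : A * U != G by rewrite -gap_neq0 // -card_gt0; card_lia.
have leU := excess_ge sUG U0 AUG.
have fI : fragment A k I by rewrite /fragment sIG I0 AIG; card_lia.
have := subset_leq_card gapI.
have := minY I fI (periodicI YH _) tI; rewrite -mulgA YH => /(_ erefl).
by card_lia.
Qed.

(** A minimal Y as in [atom_lcoset] is a coset of a subgroup.  Indeed, for u and
v in Y, the intersection of Y and (u * v) * Y contains both u and v; being a
union of cosets of H, it has at least 2 * #|H| > t elements unless u * v lies in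
H, in which case (u * v) * Y = Y anyway. *)
Lemma periodic_fragment_group H t Y :
    H \subset G -> t < 2 * #|H| ->
    fragment A k Y -> Y * H = Y -> t < #|Y| -> t < #|G :\: A * Y| ->
  exists2 L : {group gT}, fragment A k L & t < #|L|.
Proof.
move=> sHG tH.
pose P Y := [&& fragment A k Y, Y * H == Y, t < #|Y| & t < #|G :\: A * Y|].
move=> fY YH tY tgY; have PY : P Y by rewrite /P fY YH eqxx tY.
case: (arg_minnP (fun Z : {set gT} => #|Z|) PY) => {YH tY tgY}Z.
case/and4P=> fZ /eqP ZH tZ tgZ minZ; have /and4P[sZG Z0 _ _] := fZ.
have stabZ u v : u \in Z -> v \in Z -> (u * v) *: Z = Z.
  move=> Zu Zv; have [Gu Gv] := (subsetP sZG u Zu, subsetP sZG v Zv).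
  have [Huv | Huv] := boolP (u * v \in H).
    rewrite -ZH (set_commG (Y := H)) // mulgA.
    by rewrite lcoset_id.
  apply: (atom_lcoset sHG _ fZ ZH tZ tgZ); rewrite ?groupM //.
    by move=> W fW WH tW tgW; apply: minZ; rewrite /P fW WH eqxx tW.
  have sub w : w \in [set u; v] -> w *: H \subset Z :&: (u * v) *: Z.
    move=> uv_w; apply/subsetP=> _ /lcosetP[h Hh ->].
    rewrite inE mem_lcosetG ?groupM // !(mulgA _ w) !(periodic_mem _ ZH Hh).
    case/set2P: uv_w => ->.
      by rewrite Zu (commG Gu Gv) -mulgA sqG1 ?mulg1.
    by rewrite Zv -mulgA sqG1 ?mulg1.
  apply: leq_trans tH _; rewrite -(card_lcosetU (u := u) (v := v)).
    by rewrite subset_leq_card // subUset !sub ?set21 ?set22.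
  by rewrite mem_lcosetG.
have [z Zz] := set0Pn _ Z0; have Gz := subsetP sZG z Zz.
have groupL : group_set (z *: Z).
  apply/group_setP; split=> [|_ _ /lcosetP[u Zu ->] /lcosetP[v Zv ->]].
    by rewrite mem_lcosetG // mulg1.
  have [Gu Gv] := (subsetP sZG u Zu, subsetP sZG v Zv).
  rewrite mem_lcosetG // -mulgA mulKG // (commG Gz Gv) mulgA -(stabZ u v) //.
  by rewrite mem_lcosetG ?groupM // mulKG ?groupM.
exists (Group groupL); first exact: fragment_lcoset.
by rewrite /= card_lcoset.
Qed.

(** Submodularity for X and x * H: their intersection has excess at least k,
the excess of x * H, so the union has at most the excess of X. *)
Lemma grow_coset H X x :
    fragment A k H -> X \subset G -> #|A * X| < #|A| + #|X| -> x \in X ->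
    A * (X :|: x *: H) != G ->
  #|A * (X :|: x *: H)| < #|A| + #|X :|: x *: H|.
Proof.
move=> fH sXG ltX Xx neG; have [sHG _ _ _] := and4P fH.
have Gx := subsetP sXG x Xx; have sxHG : x *: H \subset G by apply: lcoset_sub.
have sIG : X :&: x *: H \subset G by rewrite subIset ?sXG.
have I0 : X :&: x *: H != set0.
  by apply/set0Pn; exists x; rewrite inE Xx lcoset_refl.
have AIG : A * (X :&: x *: H) != G.
  apply: contra neG => /eqP eqG; rewrite eqEsubset mulA_sub ?subUset ?sXG //=.
  by rewrite -{1}eqG mulgS // subIset ?subsetUl.
have := excess_ge sIG I0 AIG; have := card_mulg_submodular A X (x *: H).
have := cardsUI X (x *: H).
rewrite mulg_lcoset // !card_lcoset (fragment_card fH).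
by card_lia.
Qed.

Lemma grow_periodic H X :
    fragment A k H -> X \subset G -> #|A * X| < #|A| + #|X| ->
    A * (X * H) != G ->
  #|A * (X * H)| < #|A| + #|X * H|.
Proof.
move=> fH sXG ltX neG; have [sHG _ _ _] := and4P fH.
pose P (Z : {set gT}) :=
  [&& X \subset Z, Z \subset X * H & #|A * Z| < #|A| + #|Z|].
have PX : P X by rewrite /P subxx mulG_subl.
have [Z /and3P[sXZ sZXH ltZ] maxZ] : exists2 Z, P Z &
    forall V, P V -> #|V| <= #|Z|.
  by case: (arg_maxnP (fun Z : {set gT} => #|Z|) PX) => Z; exists Z.
suffices ZH : Z * H = Z.
  suffices <- : Z = X * H by [].
  by apply/eqP; rewrite eqEsubset sZXH -ZH mulSg.
have sZG : Z \subset G by rewrite (subset_trans sZXH) // mul_subG.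
apply: periodic_of_closed => z h Zz Hh.
have sU : Z :|: z *: H \subset X * H.
  rewrite subUset sZXH -[in X * H](mulGid H) mulgA mulSg //.
  by rewrite sub1set (subsetP sZXH).
have := maxZ (Z :|: z *: H); rewrite /P sU (subset_trans sXZ) ?subsetUl //=.
rewrite grow_coset //; last first.
  apply: contra neG => /eqP eqG; rewrite eqEsubset mulA_sub ?mul_subG //=.
  by rewrite -{1}eqG mulgS.
move=> /(_ isT) leZ; have /eqP -> : Z == Z :|: z *: H.
  by rewrite eqEcard subsetUl.
by rewrite inE mem_lcoset mulKg Hh orbT.
Qed.

(** The excess of X * H is less than #|A| <= #|A * H| = k + #|H|; since k and
this excess are multiples of #|H|, it is at most k. *)
Lemma periodic_fragment H X :
    fragment A k H -> X \subset G -> X != set0 -> #|A * X| < #|A| + #|X| ->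
    A * (X * H) != G ->
  fragment A k (X * H).
Proof.
move=> fH sXG X0 ltX neG; have [sHG _ _ _] := and4P fH.
have lt := grow_periodic fH sXG ltX neG.
rewrite /fragment; apply/and4P; split=> //; first by rewrite mul_subG.
  have [x Xx] := set0Pn _ X0; apply/set0Pn; exists x.
  by rewrite (subsetP (mulG_subl _ _)).
have leA : #|A| <= #|A * H| by rewrite subset_leq_card // mulG_subl.
have cAH := fragment_card fH.
have /dvdnP[p def_p] := dvdn_card_mulG A H.
have /dvdnP[q def_q] := dvdn_card_mulG X H.
have /dvdnP[r def_r] : #|H| %| #|A * (X * H)| by rewrite mulgA dvdn_card_mulG.
have ltr : r < p + q.
  rewrite -(ltn_pmul2r (cardG_gt0 H)) mulnDl -def_p -def_q -def_r; card_lia.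
have : r.+1 * #|H| <= (p + q) * #|H| by rewrite leq_mul2r ltr orbT.
rewrite mulnDl mulSn -def_p -def_q -def_r; card_lia.
Qed.

(** Let Y be the set on the left, and W = c * H :|: d * H.  By [grow_coset] and
duality Y has excess less than #|A|.  The set A * (Y * H) avoids the two cosets
in W, so [periodic_fragment] makes Y * H a fragment, to which
[periodic_fragment_group] applies if it is larger than H, giving a subgroup that
is a fragment and larger than H. *)
Lemma card_gap_grown H X c d :
    fragment A k H ->
    (forall L : {group gT}, fragment A k L -> #|L| <= #|H|) ->
    X \subset G -> #|A * X| < #|A| + #|X| ->
    c \in X -> d \in X -> d \notin c *: H ->
  #|G :\: A * (X :|: (c *: H :|: d *: H))| <= #|H|.
Proof.
move=> fH maxH sXG ltX Xc Xd cHd; have [sHG _ _ _] := and4P fH.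
have [Gc Gd] := (subsetP sXG c Xc, subsetP sXG d Xd).
set W := c *: H :|: d *: H; set Y := G :\: A * _.
have sWG : W \subset G by rewrite subUset !lcoset_sub.
have sXWG : X :|: W \subset G by rewrite subUset sXG.
have sYG : Y \subset G by apply: subsetDl.
have [-> | Y0] := eqVneq Y set0; first by rewrite cards0.
have AZG (Z : {set gT}) : Z \subset X :|: W -> A * Z != G.
  move=> sZ; rewrite -gap_neq0 ?(subset_trans sZ) //.
  by apply: contraNneq Y0 => gap0; rewrite -subset0 -gap0 setDS ?mulgS.
have ltXW : #|A * (X :|: W)| < #|A| + #|X :|: W|.
  rewrite /W setUA; apply: grow_coset => //.
  - by rewrite subUset sXG lcoset_sub.
  - by apply: grow_coset => //; rewrite AZG // setUS ?subsetUl.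
  - by rewrite inE Xd.
  by rewrite -setUA AZG.
have sAY : A * Y \subset G :\: (X :|: W) by apply: mulA_sub_gap.
have ltY : #|A * Y| < #|A| + #|Y|.
  have := subset_leq_card sAY; have := card_gap sXWG; rewrite -/Y.
  have := subset_leq_card sXWG; rewrite cardsD (setIidPr sXWG); card_lia.
have WH : W * H = W by rewrite mulUg -!mulgA !mulGid.
have sAYH : A * (Y * H) \subset G :\: W.
  have <- : (G :\: W) * H = G :\: W by rewrite periodicD ?mulGSid.
  by rewrite mulgA mulSg // (subset_trans sAY) // setDS ?subsetUr.
have sWgap : W \subset G :\: A * (Y * H).
  apply/subsetP=> w Ww; rewrite inE (subsetP sWG) // andbT.
  by apply: contraL Ww => /(subsetP sAYH)/setDP[].
have gtgap : #|H| < #|G :\: A * (Y * H)|.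
  have cW : #|W| = (2 * #|H|)%N := card_lcosetU cHd.
  by have := subset_leq_card sWgap; have := cardG_gt0 H; card_lia.
have AYHG : A * (Y * H) != G.
  by rewrite -gap_neq0 ?mul_subG // -card_gt0; card_lia.
have fYH := periodic_fragment fH sYG Y0 ltY AYHG.
apply: leq_trans (subset_leq_card (mulg_subl Y (group1 H))) _.
rewrite leqNgt; apply/negP=> ltYH.
have [||L fL] := periodic_fragment_group sHG _ fYH _ ltYH gtgap.
- by have := cardG_gt0 H; card_lia.
- by rewrite -mulgA mulGid.
by rewrite ltnNge maxH.
Qed.

End Fragments.

(** * The complement of the product set *)

Lemma subgroup_index8 H : H \subset G -> 4 * #|H| < #|G| ->
  exists K : {group gT}, [/\ H \subset K, K \subset G & #|G : K| = 8].
Proof.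
move=> sHG lt4; have nHG : H <| G by rewrite -sub_abelian_normal.
have pG : 2.-group G.
  rewrite -pnat_exponent; apply: (@pnat_dvd _ 2) => //.
  by apply/exponentP=> x Gx; rewrite expgS expg1 sqG1.
have pGH := quotient_pgroup H pG; have [m cGH] := p_natP pGH.
have iGH : #|G / H| = #|G : H| by rewrite card_quotient ?normal_norm.
have gt4 : 2 ^ 2 < 2 ^ m.
  by rewrite -cGH iGH -(ltn_pmul2r (cardG_gt0 H)) [ltnRHS]mulnC Lagrange.
rewrite ltn_exp2l // in gt4.
have [||Q [sQ _ cQ]] := @normal_pgroup 2 _ (m - 3) (G / H)%G (G / H)%G pGH.
- exact: normal_refl.
- by rewrite cGH pfactorK // leq_subr.
exists (coset H @*^-1 Q)%G; split=> /=; first exact: sub_cosetpre.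
  by rewrite -(quotientGK nHG) morphpreS.
rewrite -{1}(quotientGK nHG) index_cosetpre -divgS // cGH cQ.
by rewrite -expnB ?leq_subr // subKn.
Qed.

(** H is a largest subgroup that is a fragment.  If two elements of the
complement C lay in different cosets of H, then, up to fewer than #|H| elements
for each of them, B would lie in a set of at most #|H| elements by
[card_gap_grown]; but 3 * #|H| <= k < #|A|. *)
Lemma gap_sub_coset A B :
    A \subset G -> B \subset G -> is_affine_span G A G -> A != set0 ->
    #|A| <= #|B| -> A * B != G -> #|A * B| < #|A| + #|B| ->
  exists H, [/\ H \subset G, 4 * #|H| < #|G|
    & exists2 c, c \in G & G :\: A * B \subset c *: H].
Proof.
move=> sAG sBG spanA A0 leAB ABG ltAB.
set C := G :\: A * B; have sCG : C \subset G by apply: subsetDl.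
have C0 : C != set0 by rewrite gap_neq0.
have [c Cc] := set0Pn _ C0; have Gc := subsetP sCG c Cc.
have sBAC : B \subset G :\: A * C by apply: mulg_disjointC; rewrite ?subxx.
have cG := card_gap sAG sBG; rewrite -/C in cG.
have cAC := card_gap sAG sCG; have leB := subset_leq_card sBAC.
have ltAC : #|A * C| < #|A| + #|C| by card_lia.
have B0 : B != set0 by move: A0; rewrite -!card_gt0; card_lia.
have leACG : #|A| <= #|A * C|.
  by rewrite -(card_rcoset A c) subset_leq_card // mulgS ?sub1set.
have ACG : A * C != G.
  rewrite -gap_neq0 // -card_gt0; move: B0; rewrite -card_gt0; card_lia.
have [k [exA ltkA [Y0 fY0]]] := exists_fragment A0 sCG C0 ACG ltAC.
have [H fH maxH] : exists2 H : {group gT}, fragment A k H &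
    forall L : {group gT}, fragment A k L -> #|L| <= #|H|.
  (* For trivial H and t = 0 every fragment qualifies. *)
  have [||||L fL _] :=
    @periodic_fragment_group A k sAG exA 1 0 Y0 (sub1G G) _ fY0.
  - by rewrite cards1.
  - by rewrite mulg1.
  - by case/and4P: fY0 => _; rewrite card_gt0.
  - by case/and4P: fY0 => sYG _; rewrite card_gt0 gap_neq0.
  pose P (K : {group gT}) := fragment A k K.
  by case: (@arg_maxnP _ L P (fun K => #|K|) fL) => H; exists H.
have [sHG _ AHG _] := and4P fH; have cAH := fragment_card exA fH.
have ltAHG : #|A * H| < #|G|.
  by rewrite proper_card // properEneq AHG mulA_sub.
have span n := @span_card A sAG spanA H n sHG.
(* Each bound feeds the next: it yields, in turn, #|G| > 2 * #|H| because
   A * H <> G, and #|G| >= 2 * #|A| > 4 * #|H|. *)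
have le2 : 2 * #|H| <= #|A * H| by apply: (span 0); card_lia.
have le3 : 3 * #|H| <= #|A * H| by apply: (span 1%N); card_lia.
have le4 : 4 * #|H| <= #|A * H| by apply: (span 2); card_lia.
exists H; split=> //; first by card_lia.
exists c => //; apply/subsetP=> d Cd; apply: contraTT leAB => cHd.
have Gd := subsetP sCG d Cd; rewrite -ltnNge.
(* A * (x * H) has k + #|H| < #|A| + #|H| elements, and those of A * x avoid
   B. *)
have ltBx x : x \in C -> #|B :&: A * (x *: H)| < #|H|.
  move=> Cx; have Gx := subsetP sCG x Cx.
  have sAx : A :* x \subset A * (x *: H).
    by rewrite mulgS // sub1set lcoset_refl.
  have sBx : B :&: A * (x *: H) \subset A * (x *: H) :\: A :* x.
    rewrite subsetD subsetIr /= disjoint_sym disjoints_subset.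
    rewrite (subset_trans (mulgS A (_ : _ \subset C))) ?sub1set //.
    apply/subsetP=> y ACy; rewrite inE; apply: contraL ACy => /setIP[By _].
    by have /setDP[] := subsetP sBAC y By.
  have := subset_leq_card sBx; rewrite cardsD (setIidPr sAx) card_rcoset.
  rewrite mulg_lcoset // card_lcoset; have := cardG_gt0 H; card_lia.
set W := c *: H :|: d *: H; set T := B :\: A * W.
suffices leT : #|T| <= #|H|.
  have sB : B \subset T :|: (B :&: A * (c *: H) :|: B :&: A * (d *: H)).
    apply/subsetP=> b Bb; rewrite !inE Bb andbT mulgU inE.
    by do 2!case: (b \in _).
  have := subset_leq_card sB; have := ltBx c Cc; have := ltBx d Cd.
  have := cardsUI T (B :&: A * (c *: H) :|: B :&: A * (d *: H)).
  have := cardsUI (B :&: A * (c *: H)) (B :&: A * (d *: H)); card_lia.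
have sTY : T \subset G :\: A * (C :|: W).
  rewrite mulgU; apply/subsetP=> y /setDP[By AWy].
  have /setDP[Gy ACy] := subsetP sBAC y By.
  by rewrite !inE negb_or ACy AWy.
apply: leq_trans (subset_leq_card sTY) _.
exact: (card_gap_grown sAG exA fH maxH sCG ltAC Cc Cd cHd).
Qed.

(** * Numbers of representations *)

Lemma nu_ge A B g : A \subset G -> g \in G ->
  #|A :&: g *: B| <= nu A B g.
Proof.
move=> sAG Gg; have inj : injective (fun a : gT => (a, a * g)) by move=> a b [].
rewrite -(card_imset _ inj) subset_leq_card //.
apply/subsetP=> _ /imsetP[a /setIP[Aa gBa] ->]; have Ga := subsetP sAG a Aa.
rewrite !inE /= Aa mulKG // eqxx andbT (commG Ga Gg).
by rewrite -mem_lcosetG.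
Qed.

(** The set B avoids c * A * H, so g * B avoids t * A * H with t = g * c, which
is outside H.  Hence A and g * B both avoid the difference of t * A * H and
A * H, which has at least 2 * #|H| elements.  As #|A| + #|B| > 7 * #|H|, they
meet in more than #|H| elements, and each gives a representation of g. *)
Lemma full_coset_gap_nu A B H c g :
    A \subset G -> B \subset G ->
    is_affine_span G A G -> is_affine_span G B G ->
    H \subset G -> #|G : H| = 8 -> c \in G -> G :\: A * B = c *: H ->
    #|A * B| < #|A| + #|B| -> g \in A * B ->
  1 < nu A B g.
Proof.
move=> sAG sBG spanA spanB sHG iGH Gc gapE ltAB ABg.
have sABG : A * B \subset G by rewrite mul_subG.
have Gg := subsetP sABG g ABg.
have cGH : #|G| = (8 * #|H|)%N by rewrite -(Lagrange sHG) iGH mulnC.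
have h_gt0 := cardG_gt0 H.
have cAB : #|A * B| + #|H| = #|G|.
  by rewrite -(card_lcoset H c) -gapE card_gap.
have sBgap : B \subset G :\: c *: (A * H).
  rewrite -mulg_lcoset //; apply: mulg_disjointC; rewrite ?lcoset_sub //.
  by rewrite gapE.
have geB : 4 * #|H| <= #|B * H|.
  by apply: (span_card sBG spanB sHG (n := 2)); card_lia.
have leA : #|A * H| <= 4 * #|H|.
  have sBH : B * H \subset G :\: c *: (A * H).
    have <- : (G :\: c *: (A * H)) * H = G :\: c *: (A * H).
      by rewrite periodicD ?mulGSid // -!mulgA mulGid.
    exact: mulSg.
  have := subset_leq_card sBH.
  have sG : c *: (A * H) \subset G by rewrite lcoset_sub ?mul_subG.
  by rewrite cardsD (setIidPr sG) card_lcoset; card_lia.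
set t := g * c; have Gt : t \in G by rewrite groupM.
have Ht : t \notin H.
  apply: contraL ABg => Ht; have : g \in G :\: A * B.
    by rewrite gapE mem_lcosetG // (commG Gc Gg).
  by case/setDP.
(* K has index 4, so A meets at least three of its cosets, and A * H, with four
   cosets of H, differs from t * (A * H) by at least two of them. *)
pose K := (H <*> <[t]>)%G.
have sKG : K \subset G by rewrite join_subG sHG cycle_subG.
have KE : K = H :|: t *: H :> {set gT} by apply: joing_cycle.
have leK : #|K| <= 2 * #|H| by apply: card_joing_cycle.
have geK : 2 * #|H| <= #|K|.
  have /dvdnP[q def_q] : #|H| %| #|K| by rewrite cardSg ?joing_subl.
  rewrite def_q leq_mul2r; apply/orP; right.
  rewrite ltnNge; apply: contra Ht => leq1.
  have -> : H :=: K.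
    apply/eqP; rewrite eqEcard joing_subl def_q.
    by rewrite -[X in _ <= X]mul1n leq_mul2r leq1 orbT.
  by rewrite KE inE lcoset_refl orbT.
have geAK : 3 * #|K| <= #|A * K|.
  by apply: (span_card sAG spanA sKG (n := 1%N)); card_lia.
have AK : A * K = A * H :|: t *: (A * H).
  by rewrite [K : {set _}]KE mulgU mulg_lcoset.
have sU : A :|: g *: B \subset G :\: (t *: (A * H) :\: A * H).
  rewrite subUset; apply/andP; split; apply/subsetP=> x.
    move=> Ax; rewrite !inE (subsetP sAG) // andbT.
    by rewrite (subsetP (mulg_subl A (group1 H))).
  case/lcosetP=> b Bb ->; have /setDP[Gb cAHb] := subsetP sBgap b Bb.
  rewrite !inE groupM // andbT negb_and.
  rewrite mem_lcosetG // /t -mulgA mulgA; apply/orP; right; move: cAHb.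
  by rewrite mem_lcosetG // (commG Gg Gc) -mulgA mulKG.
have sD : t *: (A * H) :\: A * H \subset G.
  by rewrite subDset subsetU // lcoset_sub ?mul_subG ?orbT.
have cD : #|t *: (A * H) :\: A * H| + #|A * H| = #|A * K|.
  have := cardsUI (A * H) (t *: (A * H)); rewrite -AK setIC.
  by have := cardsID (A * H) (t *: (A * H)); card_lia.
apply: leq_trans (nu_ge B sAG Gg).
have := subset_leq_card sU; rewrite cardsD (setIidPr sD).
have := cardsUI A (g *: B); rewrite card_lcoset; card_lia.
Qed.

End ElementaryAbelian.

Lemma mu_gt1 (gT : finGroupType) (A B : {set gT}) :
  A * B != set0 -> {in A * B, forall g, 1 < nu A B g} -> 1 < mu A B.
Proof.
case/set0Pn=> g ABg nu_gt1; rewrite /mu.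
elim/big_rec: _ => [|h m ABh m_gt1]; last by rewrite leq_min nu_gt1.
apply: leq_trans (nu_gt1 g ABg) _; rewrite subset_leq_card //.
by apply/subsetP=> p; rewrite inE => /andP[].
Qed.

Theorem theorem2 (gT : finGroupType) (G : {group gT}) (A B : {set gT})
    (abelG : abelian G) (expG : exponent G = 2%N)
    (sAG : A \subset G) (sBG : B \subset G)
    (spanA : is_affine_span G A G) (spanB : is_affine_span G B G)
    (small : #|A * B| < minn (#|A| + #|B|) #|G|) :
  (exists H : {group gT}, [/\ H \subset G, #|G : H| = 8
     & exists2 C : {set gT}, C \in rcosets H G & G :\: (A * B) \subset C])
  /\ (mu A B = 1%N ->
      exists H : {group gT}, [/\ H \subset G, #|G : H| = 8
        & exists2 C : {set gT}, C \in rcosets H G & G :\: (A * B) \proper C]).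
Proof.
have sqG1 : {in G, forall x, x * x = 1}.
  by move=> x Gx; have := expg_exponent Gx; rewrite expG expgS expg1.
have gtG1 : 1 < #|G|.
  rewrite cardG_gt1; apply/eqP=> G1.
  by have := trivg_exponent G; rewrite expG G1 eqxx.
have [ltAB ltG] : #|A * B| < #|A| + #|B| /\ #|A * B| < #|G|.
  by apply/andP; rewrite -leq_min.
have ABG : A * B != G by apply: contraTneq ltG => ->; rewrite ltnn.
have A0 := span_gt0 abelG spanA gtG1; have B0 := span_gt0 abelG spanB gtG1.
have [K [sKG iGK [c Gc gapK]]] : exists K : {group gT},
    [/\ K \subset G, #|G : K| = 8
      & exists2 c, c \in G & G :\: A * B \subset c *: K].
  have [H [sHG lt4 [c Gc gapH]]] : exists H : {group gT},
      [/\ H \subset G, 4 * #|H| < #|G|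
        & exists2 c, c \in G & G :\: A * B \subset c *: H].
    have [leAB | /ltnW leBA] := leqP #|A| #|B|.
      exact: (gap_sub_coset abelG sqG1 sAG sBG spanA).
    rewrite (set_commG abelG sAG sBG) in ABG ltAB *.
    by apply: (gap_sub_coset abelG sqG1 sBG sAG spanB) => //; rewrite addnC.
  have [K [sHK sKG iGK]] := subgroup_index8 abelG sqG1 sHG lt4.
  exists K; split=> //; exists c => //.
  by rewrite (subset_trans gapH) // mulgS.
have KcG : c *: K \in rcosets K G.
  by apply/rcosetsP; exists c; rewrite // (set_commG abelG _ sKG) ?sub1set.
split=> [|mu1]; exists K; split=> //; exists (c *: K) => //.
rewrite properEneq gapK andbT; apply/eqP=> gapE.
suff : 1 < mu A B by rewrite mu1.
apply: mu_gt1 => [|g ABg].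
  have [[a Aa] [b Bb]] := (set0Pn _ A0, set0Pn _ B0).
  by apply/set0Pn; exists (a * b); rewrite mem_mulg.
exact: (full_coset_gap_nu abelG sqG1 sAG sBG spanA spanB sKG iGK Gc gapE).
Qed.
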